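(* Every nonprincipal ultrafilter $u$ on $\mathbb{N}$ is a Rosenthal family. In particular, every $\pi$-base of any nonprincipal ultrafilter on $\mathbb{N}$ is a Rosenthal family.
   Context: A Rosenthal matrix is an infinite matrix $M=(m_{k,n})_{k,n\in\mathbb{N}}$ of non-negative reals such that $\|M\|_\infty=\sup_{k\in\mathbb{N}}\sum_{n\in\mathbb{N}}m_{k,n}<\infty$. For $\varepsilon>0$ and $A\subseteq\mathbb{N}$, $M$ is $\varepsilon$-fragmented by $A$ if $\sum_{n\in A\setminus\{k\}}m_{k,n}\le\varepsilon$ for every $k\in A$. A family $\mathcal{F}$ of infinite subsets of $\mathbb{N}$ is a Rosenthal family if for every Rosenthal matrix $M$ and every $\varepsilon>0$ there is $A\in\mathcal{F}$ such that $M$ is $\varepsilon$-fragmented by $A$. A $\pi$-base of a nonprincipal ultrafilter $u$ is a family $\mathcal{B}$ of infinite subsets of $\mathbb{N}$ such that for every $A\in u$ there is $B\in\mathcal{B}$ with $B\subseteq A$. *)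

(* Defs.v *)
From mathcomp Require Import all_boot all_order all_algebra.
From mathcomp Require Import all_classical all_reals all_analysis.

Set Implicit Arguments.
Unset Strict Implicit.
Unset Printing Implicit Defensive.

Import Order.TTheory GRing.Theory Num.Theory.

Local Open Scope classical_set_scope.
Local Open Scope ring_scope.

(* Row sums are [esum]s (suprema of the finite partial sums), valued in the
   extended reals; they agree with the usual sums of series since all the
   entries are non-negative. *)
Definition matrix_norm (R : realType) (M : nat -> nat -> R) : \bar R :=
  ereal_sup [set \esum_(n in [set: nat]) (M k n)%:E | k in [set: nat]].

Definition rosenthal_matrix (R : realType) (M : nat -> nat -> R) : Prop :=
  (forall k n, 0 <= M k n) /\ (matrix_norm M < +oo)%E.

Definition fragmented (R : realType) (eps : R) (M : nat -> nat -> R)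
    (A : set nat) : Prop :=
  forall k, A k -> (\esum_(n in A `\ k) (M k n)%:E <= eps%:E)%E.

Definition rosenthal_family (R : realType) (F : set_system nat) : Prop :=
  (forall A, F A -> infinite_set A) /\
  forall (M : nat -> nat -> R) (eps : R), rosenthal_matrix M -> 0 < eps ->
    exists2 A, F A & fragmented eps M A.

Definition nonprincipal_ultrafilter (u : set_system nat) : Prop :=
  UltraFilter u /\ forall n : nat, u <> principal_filter n.

(* The members of a pi-base need not belong to the ultrafilter. *)
Definition pi_base (u B : set_system nat) : Prop :=
  (forall A, B A -> infinite_set A) /\
  forall A, u A -> exists2 C, B C & C `<=` A.

(* Main.v *)
Require Import Defs.
From mathcomp Require Import all_boot all_order all_algebra.
From mathcomp Require Import all_classical all_reals all_analysis.

(** Split each row sum at the diagonal, into the entries with [n > k] and those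
    with [n < k]. On a finite set of indices, either of these parts can be
    controlled by a greedy colouring with [r] colours: treat the indices in the
    order in which the relevant columns are already coloured, and give each row
    the colour carrying the least mass, at most [C / r]. Colouring [{0,...,N-1}]
    in this way for every [N] and taking the limit of the colours along the
    ultrafilter itself gives a colouring of all of [nat], one class of which
    belongs to the ultrafilter. Intersecting the classes obtained for the two
    parts proves the claim. *)

Set Implicit Arguments.
Unset Strict Implicit.
Unset Printing Implicit Defensive.

Import Order.TTheory GRing.Theory Num.Theory.

Local Open Scope classical_set_scope.
Local Open Scope ring_scope.

Section Ultrafilter.
Variable T : Type.
Implicit Types u : set_system T.

(** Otherwise [u] contains the complement of every fibre, hence their finite intersection, which is
    empty. *)
Lemma ultra_pigeonhole u (I : finType) (f : T -> I) :
  UltraFilter u -> exists i, u [set x | f x = i].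
Proof.
move=> uU; apply: contrapT => /forallNP nu.
have : u [set x | forall i, f x <> i].
  apply: filter_forall => i.
  by have [/nu|] := in_ultra_setVsetC [set x | f x = i] uU.
by case/filter_ex => x /(_ (f x)).
Qed.

Lemma filter_all_seq (I : eqType) u (s : seq I) (P : I -> set T) :
  Filter u -> (forall i, i \in s -> u (P i)) ->
  u [set x | forall i, i \in s -> P i x].
Proof.
move=> uF; elim: s => [|a s IHs] Ps.
  by apply: (@filterS _ u _ setT) filterT => x _ i; rewrite in_nil.
have := @filterI _ u uF _ _ (Ps a (mem_head _ _))
  (IHs (fun i si => Ps i (mem_behead (s := a :: s) si))).
by apply: filterS => x [Pa Px] i; rewrite inE => /predU1P[->|/Px].
Qed.

End Ultrafilter.

Section NonprincipalUltrafilter.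
Variable u : set_system nat.
Hypothesis u_np : nonprincipal_ultrafilter u.

Lemma nonprincipal_neq n : u [set m | m <> n].
Proof.
have [uU /(_ n) un] := u_np.
have [un1|//] := in_ultra_setVsetC [set n] uU.
(* If [[set n]] is in [u], then [u] extends the principal ultrafilter at [n], so equals it by
   maximality. *)
exfalso; apply: un; apply: (@max_filter _ _ (principal_filter_ultra n)).
by move=> A /principal_filterP An; apply: filterS un1 => m ->.
Qed.

Lemma nonprincipal_gt n : u [set m | (n < m)%N].
Proof.
have uF : Filter u by case: u_np => ?; exact: _.
have := filter_all_seq (s := iota 0 n.+1) uF (fun i _ => nonprincipal_neq i).
apply: filterS => m mn; rewrite /= ltnNge; apply/negP => le_mn.
by apply: (mn m) => //; rewrite mem_iota.
Qed.

Lemma nonprincipal_infinite A : u A -> infinite_set A.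
Proof.
have uF : ProperFilter u by case: u_np => ?; exact: _.
move=> uA /finite_seqP[s As].
have := @filterI _ u uF _ _ uA
  (filter_all_seq (s := s) uF (fun i _ => nonprincipal_neq i)).
by case/filter_ex => n []; rewrite As /= => sn /(_ n sn).
Qed.

End NonprincipalUltrafilter.

Section Sums.
Variable R : realType.
Implicit Types (f : nat -> R) (s : seq nat) (C : R).

(** Trades extended-real sums for finite real sums over duplicate-free lists. *)
Lemma esum_leP f (A : set nat) C :
  (\esum_(n in A) (f n)%:E <= C%:E)%E <->
  (forall s, uniq s -> (forall n, n \in s -> A n) -> \sum_(n <- s) f n <= C).
Proof.
split=> [le_fC s us sA|le_fC].
  rewrite -lee_fin; apply: le_trans le_fC; apply: esum_ge; exists [set` s].
    by split=> //; exact: finite_seq.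
  by rewrite -fsbig_seq // sumEFin.
apply: ge_ereal_sup => _ [X [/finite_fsetP[Y ->] YA] <-].
have uY := finmap.fset_uniq Y.
by rewrite -fsbig_seq // sumEFin lee_fin le_fC // => n /YA.
Qed.

Lemma sum_le_uniq f (P Q : pred nat) s (t : seq nat) :
  (forall n, 0 <= f n) -> uniq s ->
  (forall n, n \in s -> P n -> (n \in t) && Q n) ->
  \sum_(n <- s | P n) f n <= \sum_(n <- t | Q n) f n.
Proof.
move=> f0 us st; rewrite -[leLHS]big_filter -[leRHS]big_filter.
have us' : uniq [seq n <- s | P n] by rewrite filter_uniq.
have sub : {subset [seq n <- s | P n] <= [seq n <- t | Q n]}.
  by move=> n; rewrite !mem_filter => /andP[Pn /st/(_ Pn)]; rewrite andbC.
elim: [seq n <- s | P n] [seq n <- t | Q n] us' sub => [|a v IHv] w /=.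
  by rewrite big_nil => _ _; exact: sumr_ge0.
case/andP=> av uv sub; have aw : a \in w by apply/sub/mem_head.
rewrite big_cons (big_rem a aw) lerD2l; apply: IHv => // n vn.
have wn : n \in w by apply: sub; rewrite inE vn orbT.
move: wn; rewrite (perm_mem (perm_to_rem aw)) inE => /predU1P[na|//].
by rewrite na (negPf av) in vn.
Qed.

End Sums.

Section Colouring.
Variables (R : realType) (M : nat -> nat -> R) (C : R) (r : nat).
Hypothesis M_ge0 : forall k n, 0 <= M k n.
Hypothesis M_sum : forall k s, uniq s -> \sum_(n <- s) M k n <= C.

(* The relation [e] says which columns count; it is asymmetric, so that an index
   coloured later does not disturb the rows coloured before. *)
Lemma greedy_colouring (e : rel nat) s :
  (forall m n, e m n -> ~~ e n m) -> pairwise e s ->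
  exists c : nat -> 'I_r.+1, forall k, k \in s ->
    \sum_(n <- s | e k n && (c n == c k)) M k n <= C / r.+1%:R.
Proof.
move=> e_asym.
have e_irr n : e n n = false.
  by apply/negP => enn; have := e_asym _ _ enn; rewrite enn.
(* The head [a] is coloured last: its row sees all the columns of [s], already coloured, while no
   row of [s] sees column [a]. *)
elim: s => [_|a s IHs /= /andP[eas es]]; first by exists (fun=> ord0).
have [c cP] := IHs es.
have uniq_s : uniq s by exact: pairwise_uniq es.
have nas : a \notin s by apply/negP => /(allP eas); rewrite e_irr.
(* The colour classes share a mass of at most [C], so they cannot all exceed the average. *)
have [i iP] : exists i, \sum_(n <- s | c n == i) M a n <= C / r.+1%:R.
  apply: contrapT => /forallNP gtC.
  have : C < \sum_(n <- s) M a n.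
    rewrite (partition_big c xpredT) //=.
    have -> : C = \sum_(i < r.+1) C / r.+1%:R.
      by rewrite sumr_const card_ord -[RHS]mulr_natr divfK // pnatr_eq0.
    apply: ltr_sum => [|i _]; last by rewrite ltNge; apply/negP/gtC.
    by apply/(@hasP _ xpredT); exists ord0 => //; exact: mem_index_enum.
  by rewrite ltNge M_sum.
exists (fun n => if n == a then i else c n) => k.
rewrite inE big_cons eqxx => /predU1P[->|sk].
  rewrite e_irr eqxx /=; apply: le_trans iP.
  apply: sum_le_uniq => // n sn /andP[_]; rewrite sn /=.
  by case: (n =P a) => // na; rewrite -na sn in nas.
have ka : k == a = false by apply: contraNF nas => /eqP <-.
rewrite (negPf (e_asym _ _ (allP eas k sk))) /= ka.
apply: le_trans (cP k sk); apply: sum_le_uniq => // n sn; rewrite sn.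
by case: (n =P a) => // na; rewrite -na sn in nas.
Qed.

(** Used with [e] as [<] and as [>]; [s N] lists the indices below [N] in the order of [e]. *)
Lemma half_fragmented (u : set_system nat) (e : rel nat) (s : nat -> seq nat) :
  nonprincipal_ultrafilter u ->
  (forall m n, e m n -> ~~ e n m) -> (forall N, pairwise e (s N)) ->
  (forall n N, (n < N)%N -> n \in s N) ->
  exists2 A, u A & forall k t, A k -> uniq t -> (forall n, n \in t -> A n) ->
    \sum_(n <- t | e k n) M k n <= C / r.+1%:R.
Proof.
move=> u_np e_asym es sP; have [uU _] := u_np.
have [c cP] := choice (fun N => greedy_colouring e_asym (es N)).
(* [d k] is the limit along [u] of the colours [c N k]. *)
have [d dP] := choice (fun k => ultra_pigeonhole (c^~ k) uU).
have [i ui] := ultra_pigeonhole d uU.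
exists [set k | d k = i] => // k t dk ut dt.
(* Only finitely many indices are involved, so a single [N] exceeds them all and gives each its
   limit colour. *)
have : u [set N | forall n, n \in k :: t -> (n < N)%N /\ c N n = i].
  apply: filter_all_seq => n ktn; apply: filterI (nonprincipal_gt u_np n) _.
  suff <- : d n = i by exact: dP.
  by move: ktn; rewrite inE => /predU1P[->|/dt].
case/filter_ex => N cN; have [kN ck] := cN k (mem_head _ _).
apply: le_trans (cP N k (sP _ _ kN)); apply: sum_le_uniq => // n tn ekn.
have [nN cn] : (n < N)%N /\ c N n = i by apply: cN; rewrite inE tn orbT.
by rewrite sP // ekn cn ck eqxx.
Qed.

End Colouring.

Lemma rosenthal_sum_bound (R : realType) (M : nat -> nat -> R) :
  rosenthal_matrix M ->
  exists C : R, forall k s, uniq s -> \sum_(n <- s) M k n <= C.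
Proof.
case=> M0 Mfin.
have rowM k : (\esum_(n in [set: nat]) (M k n)%:E <= matrix_norm M)%E.
  by apply: ereal_sup_ubound; exists k.
have M_ge0 : (0 <= matrix_norm M)%E.
  by apply: le_trans (rowM 0%N); apply: esum_ge0 => n _; rewrite lee_fin.
exists (fine (matrix_norm M)) => k s us.
have /esum_leP : (\esum_(n in [set: nat]) (M k n)%:E <= (fine (matrix_norm M))%:E)%E.
  by rewrite fineK ?ge0_fin_numE.
exact.
Qed.

Lemma ultrafilter_fragmented (R : realType) (u : set_system nat)
    (M : nat -> nat -> R) (eps : R) :
  nonprincipal_ultrafilter u -> rosenthal_matrix M -> 0 < eps ->
  exists2 A, u A & fragmented eps M A.
Proof.
move=> u_np RM eps0; have [uU _] := u_np; have [M0 _] := RM.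
have [C MC] := rosenthal_sum_bound RM.
have C0 : 0 <= C by have := MC 0%N [::] isT; rewrite big_nil.
(* Enough colours for each side of the diagonal to cost at most [eps / 2]. *)
pose r := Num.truncn (C / (eps / 2)).
have Cr : C / r.+1%:R <= eps / 2.
  rewrite ler_pdivrMr // mulrC -ler_pdivrMr ?divr_gt0 //.
  by apply/ltW/truncnS_gt.
have lt_asym m n : (m < n -> ~~ (n < m))%N by move=> mn; rewrite -leqNgt ltnW.
have [A uA AP] : exists2 A, u A & forall k t, A k -> uniq t ->
    (forall n, n \in t -> A n) -> \sum_(n <- t | (k < n)%N) M k n <= C / r.+1%:R.
  apply: (half_fragmented r M0 MC (e := ltn) (s := iota 0)) => // [N|n N nN].
    by rewrite -(sorted_pairwise ltn_trans) iota_ltn_sorted.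
  by rewrite mem_iota.
have [B uB BP] : exists2 A, u A & forall k t, A k -> uniq t ->
    (forall n, n \in t -> A n) -> \sum_(n <- t | (n < k)%N) M k n <= C / r.+1%:R.
  (* The list is now decreasing, so small indices are coloured first. *)
  apply: (half_fragmented r M0 MC (e := fun m n => (n < m)%N)
            (s := fun N => rev (iota 0 N))) => // [m n|N|n N nN].
  - exact: lt_asym.
  - rewrite -sorted_pairwise ?rev_sorted ?iota_ltn_sorted //.
    by move=> m n p nm pn; exact: ltn_trans pn nm.
  - by rewrite mem_rev mem_iota.
exists (A `&` B); first exact: filterI.
move=> k [Ak Bk]; apply/esum_leP => s us sAB.
have kNs : k \notin s by apply/negP => /sAB[_]; apply.
rewrite (bigID (fun n => (k < n)%N)) /= (splitr eps) lerD //.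
  by apply: le_trans Cr; apply: AP => // n /sAB[[]].
apply: le_trans Cr; apply: le_trans (BP k s Bk us _); last by move=> n /sAB[[]].
apply: sum_le_uniq => // n sn; rewrite sn -leqNgt leq_eqVlt => /predU1P[nk|//].
by rewrite -nk sn in kNs.
Qed.

(** Lets a member of a pi-base inherit fragmentation from the ultrafilter set containing it. *)
Lemma fragmented_subset (R : realType) (eps : R) (M : nat -> nat -> R)
    (A B : set nat) : B `<=` A -> fragmented eps M A -> fragmented eps M B.
Proof.
move=> BA fA k Bk; apply: le_trans (fA k (BA _ Bk)).
apply: ereal_sup_le => _ [X [finX XB] <-]; exists X => //; split=> // n /XB[Bn kn].
by split=> //; exact: BA.
Qed.

Theorem theorem3p4 (R : realType) :
  (forall u : set_system nat,
     nonprincipal_ultrafilter u -> rosenthal_family R u) /\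
  (forall u B : set_system nat,
     nonprincipal_ultrafilter u -> pi_base u B -> rosenthal_family R B).
Proof.
split=> [u u_np|u B u_np [B_inf uB]].
  split=> [A|M eps]; first exact: nonprincipal_infinite.
  exact: ultrafilter_fragmented.
split=> // M eps RM eps0.
have [A uA fA] := ultrafilter_fragmented u_np RM eps0.
by have [D BD DA] := uB A uA; exists D => //; exact: fragmented_subset fA.
Qed.
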